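(* Let $p$ be an odd prime. Then \[ \sum_{n=0}^{\frac{p-1}{2}} \frac{(\frac{1}{2})_{n}^3}{n!^3} (42n+5) \frac{1}{64^n} \equiv 5p (-1)^{\frac{p-1}{2}} \pmod{p^4}. \]
   Context: For a real number $a$ and a nonnegative integer $n$, $(a)_n$ denotes the Pochhammer symbol: $(a)_0=1$ and $(a)_n=a(a+1)\cdots(a+n-1)$ for $n\ge 1$. For rational numbers $x,y$ and an integer $m\ge1$, $x\equiv y \pmod{p^m}$ means that $(x-y)/p^m$ is a rational number whose denominator (in lowest terms) is not divisible by $p$. This congruence is known as Van Hamme's supercongruence (K.2). *)

(* Defs.v *)
From mathcomp Require Import all_boot all_order all_algebra.

Set Implicit Arguments.
Unset Strict Implicit.
Unset Printing Implicit Defensive.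

Import Order.TTheory GRing.Theory Num.Theory.

Local Open Scope ring_scope.

Definition pochhammer (R : pzSemiRingType) (a : R) (n : nat) : R :=
  \prod_(i < n) (a + i%:R).

(* [denq] is the positive denominator of the reduced fraction. *)
Definition eqmod_pow (p m : nat) (x y : rat) : bool :=
  ~~ (p%:Z %| denq ((x - y) / p%:R ^+ m))%Z.

(* Main.v *)
(* Write p = 2N + 1 and h = p / 2.  With c_n = (1/2)_n / (n!^2 16^n), the sum
   is the value at x = 0 of
     T(x) = sum_(n <= N) c_n (84n^2 + 56nx + 4x^2 + 52n + 12x + 5)
              (1/2 + x)_n^2 (1/2 - x)_n / (1 + x)_(2n+1),
   and x is a WZ parameter: (x + 1/2) T(x+1) - (x + 1) T(x) is an explicit
   multiple of (1/2 + x)_(N+1)^2 (1/2 - x)_N.  Starting from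
   x = 1/2, where only n = 0 contributes, it yields closed forms for T(h), for
   T(-h) = 0 and for T'(-h).  After removal of the pole of T at x = -p and
   multiplication by (1 + x)_(p-1) (1 + x)_N, T becomes a polynomial Phi with
   p-integral coefficients, and Hermite interpolation
     4 Phi(0) = Phi(h) + 3 Phi(-h) + 2h Phi'(-h)
   is valid modulo p^4 as soon as p divides the coefficient of x^3 in Phi.
   Modulo p the WZ relation becomes homogeneous: it says that a multiple of Phi
   is, up to the removed pole, invariant under x -> x + 1, hence a polynomial
   in x^p - x, which has no term in x^4 for p >= 5.  The remaining products are
   constant modulo p^3 on pZ_p because they are reflection-symmetric and their
   x^2-coefficients vanish modulo p by the same periodicity argument. *)

From HB Require Import structures.
Require Import Defs.
From mathcomp Require Import all_boot all_order all_algebra finfield.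
From mathcomp Require Import ring lra zify.
Set Implicit Arguments.
Unset Strict Implicit.
Unset Printing Implicit Defensive.
Import Order.TTheory GRing.Theory Num.Theory.
Local Open Scope ring_scope.

(** * The WZ recurrence *)

Section Pochhammer.
Variable A : comNzRingType.
Implicit Types (a x : A) (m n : nat).

Lemma pochhammer0 a : pochhammer a 0 = 1.
Proof. by rewrite /pochhammer big_ord0. Qed.

Lemma pochhammerSr a n : pochhammer a n.+1 = pochhammer a n * (a + n%:R).
Proof. by rewrite /pochhammer big_ord_recr. Qed.

Lemma pochhammerD a m n :
  pochhammer a (m + n) = pochhammer a m * pochhammer (a + m%:R) n.
Proof.
elim: n => [|n IHn]; first by rewrite addn0 pochhammer0 mulr1.
by rewrite addnS !pochhammerSr IHn natrD addrA mulrA.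
Qed.

Lemma pochhammerSl a n : pochhammer a n.+1 = a * pochhammer (a + 1) n.
Proof. by rewrite -add1n pochhammerD pochhammerSr pochhammer0 mul1r addr0. Qed.

Lemma pochhammer_eq0 a m n : a + m%:R = 0 -> (m < n)%N -> pochhammer a n = 0.
Proof.
move=> am0 /subnKC <-; rewrite addSnnS pochhammerD pochhammerSl am0.
by rewrite mul0r mulr0.
Qed.

Lemma pochhammer1 n : pochhammer (1 : A) n = n`!%:R.
Proof.
elim: n => [|n IHn]; first by rewrite pochhammer0.
by rewrite pochhammerSr IHn factS mulnC natrM [in RHS]mulrS.
Qed.

(** Reading the product backwards flips the sign of each of its [n] factors. *)
Lemma pochhammer_refl a n :
  pochhammer a n = (-1) ^+ n * pochhammer (1 - n%:R - a) n.
Proof.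
elim: n a => [|n IHn] a; first by rewrite !pochhammer0 mulr1.
rewrite pochhammerSr pochhammerSl IHn exprS.
rewrite (_ : 1 - n.+1%:R - a + 1 = 1 - n%:R - a) ?[in RHS]mulrS.
  ring.
by rewrite !mulrS; ring.
Qed.

End Pochhammer.

Lemma rmorph_pochhammer (A B : comNzRingType) (f : {rmorphism A -> B}) a n :
  f (pochhammer a n) = pochhammer (f a) n.
Proof.
by rewrite rmorph_prod; apply: eq_bigr => i _; rewrite rmorphD rmorph_nat.
Qed.

Section WZ.
Variable A : comNzRingType.
Variables (h : A) (c : nat -> A).
Implicit Types (x : A) (n N : nat).

Definition wz_factor n x : A :=
  84 * n%:R ^+ 2 + 56 * n%:R * x + 4 * x ^+ 2 + 52 * n%:R + 12 * x + 5.

Definition wz_term n x : A :=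
  c n * pochhammer (h + x) n ^+ 2 * pochhammer (h - x) n.

(* This is (1 + x)_(2N+1) T(x), with T as above. *)
Fixpoint wz_sum N x : A :=
  if N is n.+1 then
    wz_sum n x * (x + (2 * N)%:R) * (x + (2 * N).+1%:R)
      + wz_factor N x * wz_term N x
  else wz_factor 0 x * wz_term 0 x.

Hypothesis h2 : 2 * h = 1.

(** Induction on [N]: passing to [N.+1] multiplies the old relation by two linear factors, and the
    new summands account exactly for the change of the boundary term. *)
Lemma wz_telescope N x :
    (forall n, (n < N)%N ->
       16 * n.+1%:R ^+ 2 * c n.+1 = c n * (h + n%:R)) ->
  wz_sum N (x + 1) * (x + h) = (x + (2 * N).+2%:R) * wz_sum N x
    + 4 * c N * (h + N%:R) * pochhammer (h + x) N.+1 ^+ 2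
        * pochhammer (h - x) N.
Proof.
have E k : k%:R = (2 * k)%:R * h :> A by rewrite mulnC natrM -mulrA h2 mulr1.
(* With 1 = 2h the identity becomes homogeneous in x, N and h. *)
have factorE n y : wz_factor n y = 84 * n%:R ^+ 2 + 56 * n%:R * y + 4 * y ^+ 2
    + 104 * n%:R * h + 24 * y * h + 20 * h ^+ 2.
  transitivity (84 * n%:R ^+ 2 + 56 * n%:R * y + 4 * y ^+ 2
    + 52 * n%:R * (2 * h) + 12 * y * (2 * h) + 5 * (2 * h) ^+ 2); last by ring.
  by rewrite h2 /wz_factor; ring.
elim: N => [|N IHN] cS.
  rewrite /= !factorE /wz_term !(pochhammerSr, pochhammer0) !addr0 muln0.
  have -> : 2%:R = 4 * h :> A by rewrite E.
  rewrite -[X in x + X]h2.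
  by ring.
rewrite /= mulrDl.
have -> : (2 * N.+1 = (2 * N).+2)%N by lia.
set M := (2 * N).+2.
have -> : x + 1 + M.+1%:R = x + M.+2%:R by rewrite [in RHS]mulrS; ring.
have -> : x + 1 + M%:R = x + M.+1%:R by rewrite [in RHS]mulrS; ring.
rewrite [X in X + _ = _](_ : _ = (x + M.+1%:R) * (x + M.+2%:R)
  * (wz_sum N (x + 1) * (x + h))); last by ring.
rewrite IHN; last by move=> n nN; apply: cS; rewrite ltnS ltnW.
rewrite /wz_term.
have cN : 4 * c N * (h + N%:R) = 64 * N.+1%:R ^+ 2 * c N.+1.
  by rewrite -mulrA -cS //; ring.
rewrite cN.
(* All shifted products are written over the common factors [P] and [R], which leaves a polynomial
   identity. *)
set P := pochhammer (h + x + 1) N.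
have P1 : pochhammer (h + x) N.+1 = (h + x) * P by rewrite pochhammerSl.
have P2 : pochhammer (h + (x + 1)) N.+1 = P * (h + x + N.+1%:R).
  by rewrite addrA pochhammerSr mulrSr; congr (_ * _); ring.
have P3 : pochhammer (h + x) N.+2 = (h + x) * P * (h + x + N.+1%:R).
  by rewrite pochhammerSr P1.
set R := pochhammer (h - x) N.
have R1 : pochhammer (h - x) N.+1 = R * (h - x + N%:R) by rewrite pochhammerSr.
have R2 : pochhammer (h - (x + 1)) N.+1 = (h - x - 1) * R.
  rewrite pochhammerSl; congr (_ * _); first by ring.
  by congr (pochhammer _ _); ring.
rewrite P1 P2 P3 R1 R2 !factorE /M.
have -> : (2 * N).+4%:R = 2 * N%:R + 8 * h :> A.
  by rewrite -[in LHS]addn4 natrD natrM [4%:R]E; ring.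
have -> : (2 * N).+3%:R = 2 * N%:R + 6 * h :> A.
  by rewrite -[in LHS]addn3 natrD natrM [3%:R]E; ring.
have -> : (2 * N).+2%:R = 2 * N%:R + 4 * h :> A.
  by rewrite -[in LHS]addn2 natrD natrM [2%:R]E; ring.
have -> : N.+1%:R = N%:R + 2 * h :> A by rewrite mulrSr h2.
have -> : x + 1 = x + 2 * h by rewrite h2.
have -> : h - x - 1 = h - x - 2 * h by rewrite h2.
move: (wz_sum N x) (c N.+1) => q d.
by ring.
Qed.

End WZ.

Lemma rmorph_wz_term (A B : comNzRingType) (f : {rmorphism A -> B}) h c d n x :
  (forall i, f (c i) = d i) ->
  f (wz_term h c n x) = wz_term (f h) d n (f x).
Proof.
move=> cd; rewrite /wz_term.
by rewrite !(rmorphM, rmorphXn, rmorph_pochhammer, rmorphD, rmorphN) cd.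
Qed.

Lemma rmorph_wz_sum (A B : comNzRingType) (f : {rmorphism A -> B}) h c d N x :
  (forall i, f (c i) = d i) ->
  f (wz_sum h c N x) = wz_sum (f h) d N (f x).
Proof.
move=> cd.
have factorE n : f (wz_factor n x) = wz_factor n (f x).
  by rewrite /wz_factor !(rmorphD, rmorphM, rmorphXn, rmorph_nat).
elim: N => [|N IHN] /=; first by rewrite rmorphM factorE (rmorph_wz_term _ _ _ cd).
rewrite rmorphD [f (wz_factor _ _ * _)]rmorphM factorE (rmorph_wz_term _ _ _ cd).
by rewrite 2!rmorphM IHN !(rmorphD f x) !rmorph_nat.
Qed.

(** * Closed forms at 1/2 + j *)

Section Values.
Variable A : comNzRingType.
Variables (h : A) (c : nat -> A).
Hypotheses (h2 : 2 * h = 1) (c0 : c 0%N = 1).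

Lemma wz_sum_half N : wz_sum h c N h = 8 * pochhammer (h + 1) (2 * N).+1.
Proof.
elim: N => [|N IHN] /=.
  rewrite muln0 /wz_term /wz_factor c0 pochhammerSr !pochhammer0.
  (* The factor 4x^2 + 12x + 5 takes the value 12 = 8 (h + 1) at x = h. *)
  transitivity ((2 * h) ^+ 2 + 6 * (2 * h) + 5); first by ring.
  transitivity (4 * (2 * h) + (8 : A)); last by ring.
  by rewrite h2; ring.
rewrite /wz_term subrr (@pochhammer_eq0 _ 0 0) ?addr0 // !mulr0 addr0 IHN.
have -> : (2 * N.+1 = (2 * N).+2)%N by lia.
rewrite [in RHS]pochhammerSr [in RHS]pochhammerSr -!addrA -!mulrS.
by rewrite !mulrA.
Qed.

Section Chain.
Variable N : nat.
Hypothesis cS : forall n, (n < N)%N ->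
  16 * n.+1%:R ^+ 2 * c n.+1 = c n * (h + n%:R).

(** At x = h + j with j < N the boundary term contains (-j)_N = 0, so the WZ relation becomes a
    first-order recurrence climbing from 1/2 to 1/2 + N = p/2. *)
Lemma wz_sum_half_nat j : (j <= N)%N ->
  j`!%:R * wz_sum h c N (h + j%:R) = 8 * pochhammer (h + 1) ((2 * N).+1 + j).
Proof.
elim: j => [|j IHj] jN; first by rewrite addr0 wz_sum_half addn0 mul1r.
have := wz_telescope h2 (h + j%:R) cS.
rewrite [pochhammer (h - _) N](@pochhammer_eq0 _ _ j) //; last by ring.
rewrite mulr0 addr0 => E.
have jS : h + j%:R + h = j.+1%:R :> A by rewrite mulrS -h2; ring.
have -> : h + j.+1%:R = h + j%:R + 1 by rewrite mulrSr addrA.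
transitivity (j`!%:R * (wz_sum h c N (h + j%:R + 1) * (h + j%:R + h))).
  by rewrite jS factS natrM; ring.
rewrite E mulrCA IHj 1?ltnW // addnS pochhammerSr natrD [(2 * N).+2%:R]mulrS.
by ring.
Qed.
End Chain.
End Values.

Section Quotient.
Variable A : comNzRingType.
Variables (h : A) (c : nat -> A).

(* With p = 2N + 3, the last summand comes from
   wz_factor N.+1 x = (x + p) (21p + 7x - 16) - 3x^2. *)
Definition wz_quot N x : A :=
  wz_sum h c N x * (x + (2 * N).+2%:R)
    + (21 * (2 * N).+3%:R + 7 * x - 16) * wz_term h c N.+1 x.

Lemma wz_quotE N x : wz_sum h c N.+1 x =
  (x + (2 * N).+3%:R) * wz_quot N x - 3 * x ^+ 2 * wz_term h c N.+1 x.
Proof.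
rewrite /wz_quot /= (_ : 2 * N.+1 = (2 * N).+2)%N; last by lia.
have -> : (2 * N).+3%:R = 2 * N.+1%:R + 1 :> A.
  by rewrite -natrM natr1 mulnS.
have -> : (2 * N).+2%:R = 2 * N.+1%:R :> A by rewrite -natrM mulnS.
by rewrite /wz_factor; ring.
Qed.
End Quotient.

Section Polynomials.
Variable A : comNzRingType.
Variables (h : A) (c : nat -> A).

Definition wz_poly N : {poly A} := wz_sum h%:P (polyC \o c) N 'X.

Lemma horner_wz_poly N x : (wz_poly N).[x] = wz_sum h c N x.
Proof.
rewrite -/(horner_eval x _) (@rmorph_wz_sum _ _ _ _ _ c).
  by rewrite /= /horner_eval hornerX hornerC.
by move=> i; apply: hornerC.
Qed.

Lemma comp_wz_poly N (q : {poly A}) :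
  wz_poly N \Po q = wz_sum h%:P (polyC \o c) N q.
Proof.
rewrite (@rmorph_wz_sum _ _ (comp_poly q) _ _ (polyC \o c)).
  by rewrite /= comp_polyC comp_polyX.
by move=> i; apply: comp_polyC.
Qed.

Lemma wz_poly_telescope N :
    2 * h = 1 ->
    (forall n, (n < N)%N ->
       16 * n.+1%:R ^+ 2 * c n.+1 = c n * (h + n%:R)) ->
  (wz_poly N \Po ('X + 1)) * ('X + h%:P)
  = ('X + (2 * N).+2%:R) * wz_poly N
    + 4 * (c N)%:P * (h%:P + N%:R) * pochhammer (h%:P + 'X) N.+1 ^+ 2
        * pochhammer (h%:P - 'X) N.
Proof.
move=> h2 cS; rewrite comp_wz_poly wz_telescope //.
  by rewrite -polyC_natr -polyCM h2.
move=> n nN /=; rewrite -!polyC_natr -polyC_exp -!polyCM cS //.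
by rewrite polyCM polyCD.
Qed.

End Polynomials.

Lemma horner_pochhammer (A : comNzRingType) (q : {poly A}) n x :
  (pochhammer q n).[x] = pochhammer q.[x] n.
Proof. by rewrite -/(horner_eval x _) rmorph_pochhammer. Qed.

(** * Values and derivatives at -1/2 - j *)

Section DoubleZeros.
Variables (h : rat) (c : nat -> rat) (N : nat).
Hypotheses (h2 : 2 * h = 1) (c0 : c 0%N = 1) (cS : forall n, (n < N)%N ->
  16 * n.+1%:R ^+ 2 * c n.+1 = c n * (h + n%:R)).

Let Q := wz_poly h c N.

(** The boundary term contains the square of (h + x)_(N+1), which vanishes at x = -h - j; hence it
    drops out of the relation and of its derivative. *)
Lemma wz_step j : (j <= N)%N -> let x := - h - j%:R in
  Q.[x + 1] * - j%:R = (h + ((2 * N).+1 - j)%:R) * Q.[x] /\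
  Q^`().[x + 1] * - j%:R + Q.[x + 1] =
    (h + ((2 * N).+1 - j)%:R) * Q^`().[x] + Q.[x].
Proof.
move=> jN x; rewrite /Q.
have := wz_poly_telescope h2 cS.
rewrite -!polyC_natr -!polyC1.
have Sx : (pochhammer (h%:P + 'X) N.+1).[x] = 0.
  rewrite horner_pochhammer (@pochhammer_eq0 _ _ j) //.
  by rewrite hornerD hornerC hornerX /x; ring.
move: (pochhammer _ N.+1) Sx => S Sx.
have xM : x + (2 * N).+2%:R = h + ((2 * N).+1 - j)%:R.
  rewrite natrB ?(leq_trans jN) //; last by lia.
  by rewrite [(2 * N).+2%:R]mulrS /x; move: h2; lra.
have xh : x + h = - j%:R by rewrite /x; ring.
move=> E; split.
  have := congr1 (fun q => q.[x]) E.
  rewrite !(hornerM, hornerD, horner_exp, horner_comp, hornerX, hornerC) Sx.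
  by rewrite xM xh => ->; ring.
have := congr1 (fun q => q^`().[x]) E.
rewrite !(derivM, derivD, derivXn, deriv_comp, derivX, derivC).
rewrite !(hornerM, hornerD, horner_exp, horner_comp, hornerX, hornerC) Sx.
rewrite xM xh !(addr0, mulr1, mul1r, mul0r, mulr0) => ->.
by rewrite addrC.
Qed.

Lemma half_gt0 : 0 < h.
Proof. by move: h2; lra. Qed.

(** For j = 0 the coefficient -j vanishes: this forces Q(-h) = 0, and the differentiated relation
    expresses Q'(-h) by Q(1 - h) = Q(h), which is known. Each further step down divides by some h +
    m, nonzero in [rat]. *)
Lemma wz_double_zero j : (j <= N)%N ->
  Q.[- h - j%:R] = 0 /\
  Q^`().[- h - j%:R] * pochhammer (h + ((2 * N).+1 - j)%:R) j
    = 8 * (-1) ^+ j * j`!%:R * pochhammer (h + 1) (2 * N).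
Proof.
have hn0 m : h + m%:R != 0 by rewrite gt_eqF // ltr_wpDr // half_gt0.
elim: j => [|j IHj] jN.
  have [E1 E2] := wz_step jN.
  rewrite subr0 oppr0 mulr0 in E1 E2; rewrite subr0.
  have Q0 : Q.[- h] = 0.
    by apply: (mulfI (hn0 ((2 * N).+1 - 0)%N)); rewrite -E1 mulr0.
  split=> //; rewrite pochhammer0 expr0 !mulr1.
  have Qh : Q.[- h + 1] = 8 * pochhammer (h + 1) (2 * N).+1.
    by rewrite (_ : _ + 1 = h) ?horner_wz_poly ?wz_sum_half //; move: h2; lra.
  apply: (mulfI (hn0 ((2 * N).+1 - 0)%N)).
  move: E2; rewrite Q0 mulr0 addr0 add0r Qh => <-.
  by rewrite subn0 pochhammerSr mulrS; ring.
have [Q0 D] := IHj (ltnW jN).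
have [] := wz_step jN.
have -> : - h - j.+1%:R + 1 = - h - j%:R by rewrite mulrS; ring.
rewrite Q0 mul0r addr0 => /esym/eqP.
rewrite mulf_eq0 (negPf (hn0 _)) /= => /eqP Q1 E2.
split=> //; rewrite Q1 addr0 in E2.
rewrite pochhammerSl mulrA [_ * (h + _)]mulrC -E2.
have -> : h + ((2 * N).+1 - j.+1)%:R + 1 = h + ((2 * N).+1 - j)%:R.
  by rewrite subSS -addrA natr1 subSn // (leq_trans (ltnW jN)) // leq_pmull.
rewrite mulrAC D exprS factS natrM; ring.
Qed.

End DoubleZeros.

(** * Degree bounds *)

Section Size.
Variable R : comNzRingType.
Implicit Types q r : {poly R}.

Lemma size_mul_bound q r a b :
  (size q <= a)%N -> (size r <= b)%N -> (size (q * r)%R <= (a + b).-1)%N.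
Proof.
move=> qa rb; apply: leq_trans (size_polyMleq _ _) _.
by rewrite -!subn1 leq_sub2r // leq_add.
Qed.

Lemma size_add_bound q r a :
  (size q <= a)%N -> (size r <= a)%N -> (size (q + r)%R <= a)%N.
Proof. by move=> qa ra; rewrite (leq_trans (size_polyD _ _)) // geq_max qa. Qed.

Lemma size_nat_poly k : (size (k%:R : {poly R}) <= 1)%N.
Proof. by rewrite -polyC_natr size_polyC_leq1. Qed.

Lemma size_pochhammer q n :
  (size q <= 2)%N -> (size (pochhammer q n) <= n.+1)%N.
Proof.
move=> q2; elim: n => [|n IHn]; first by rewrite pochhammer0 size_polyC_leq1.
rewrite pochhammerSr -[n.+2]/(n.+2.+1.-1) -(addn2 n.+1).
apply/size_mul_bound/size_add_bound => //.
exact: leq_trans (size_nat_poly n) _.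
Qed.

End Size.

(** Summand n has degree at most 3n + 2, while the two linear factors of the recursion raise the
    earlier degree by 2 only. *)
Lemma size_wz_poly (R : comNzRingType) (h : R) c N :
  (size (wz_poly h c N) <= 3 * N + 3)%N.
Proof.
have sA := @size_mul_bound R.
have sC (a : R) : (size a%:P <= 1)%N := size_polyC_leq1 a.
have sX : (size ('X : {poly R}) <= 2)%N by rewrite size_polyX.
have sterm n : (size (wz_term h%:P (polyC \o c) n 'X) <= (3 * n).+1)%N.
  have s1 : (size (pochhammer (h%:P + 'X) n) <= n.+1)%N.
    by apply/size_pochhammer/size_add_bound => //; apply: leq_trans (sC h) _.
  have s2 : (size (pochhammer (h%:P - 'X) n) <= n.+1)%N.
    apply/size_pochhammer/size_add_bound; first exact: leq_trans (sC h) _.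
    by rewrite size_polyN.
  apply: leq_trans (sA _ _ _ _ (sA _ _ _ _ (sC (c n)) (sA _ _ _ _ s1 s1)) s2) _.
  lia.
have sfactor n : (size (wz_factor n ('X : {poly R})) <= 3)%N.
  have sx2 : (size ('X ^+ 2 : {poly R}) <= 3)%N by rewrite size_polyXn.
  have sk k (q : {poly R}) a : (size q <= a)%N -> (size (k%:R * q)%R <= a)%N.
    by rewrite -polyC_natr => /(sA _ _ _ _ (sC k%:R)).
  have sk0 k : (size (k%:R : {poly R}) <= 3)%N.
    by rewrite -polyC_natr (leq_trans (sC _)).
  have sx3 : (size ('X : {poly R}) <= 3)%N by rewrite size_polyX.
  rewrite /wz_factor; do !apply: size_add_bound; rewrite -?mulrA;
    do ?apply: (sk _ _ _) => //; rewrite ?size_poly1 //;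
    by rewrite -?natrX; apply: (sk0 _).
rewrite /wz_poly; elim: N => [|N IHN] /=.
  by apply: leq_trans (sA _ _ _ _ (sfactor 0%N) (sterm 0%N)) _.
apply: size_add_bound; last first.
  by apply: leq_trans (sA _ _ _ _ (sfactor N.+1) (sterm N.+1)) _; lia.
have sXn k : (size ('X + k%:R : {poly R})%R <= 2)%N.
  apply: size_add_bound => //; rewrite -polyC_natr.
  exact: leq_trans (sC _) _.
by apply: leq_trans (sA _ _ _ _ (sA _ _ _ _ IHN (sXn _)) (sXn _)) _; lia.
Qed.

Lemma fact_double (R : comNzRingType) (h : R) n : 2 * h = 1 ->
  (2 * n)`!%:R = 4 ^+ n * pochhammer h n * n`!%:R :> R.
Proof.
move=> h2; elim: n => [|n IHn]; first by rewrite pochhammer0 !mulr1.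
have -> : (2 * n.+1 = (2 * n).+2)%N by lia.
rewrite !factS !natrM IHn exprS pochhammerSr.
have -> : (2 * n).+2%:R = 2 * n.+1%:R :> R by rewrite -natrM mulnS.
have -> : (2 * n).+1%:R = 2 * (h + n%:R) :> R.
  by rewrite mulrDr h2 -natr1 natrM addrC.
ring.
Qed.

(** * The value at x = 0 *)

Section SumAtZero.
Variables (F : numFieldType) (h : F) (c : nat -> F) (N : nat).
Hypotheses (h2 : 2 * h = 1) (cE : forall n, (n <= N)%N ->
  c n = pochhammer h n / (n`!%:R ^+ 2 * 16 ^+ n)).

Let a n := pochhammer h n ^+ 3 / n`!%:R ^+ 3 * (42 * n%:R + 5) * (1 / 64 ^+ n).

(** At x = 0 the factor 84n^2 + 52n + 5 splits as (2n + 1)(42n + 5), and (2n)! = 4^n (1/2)_n n!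
    supplies the 4^n that turns 16^n into 64^n. *)
Lemma wz_summand0 n : (n <= N)%N ->
  wz_factor n 0 * wz_term h c n 0 = (2 * n).+1`!%:R * a n.
Proof.
move=> nN; rewrite /wz_term addr0 subr0 factS natrM (fact_double n h2).
have nf : n`!%:R != 0 :> F by rewrite pnatr_eq0 -lt0n fact_gt0.
have -> : (2 * n).+1%:R = 2 * n%:R + 1 :> F by rewrite -natr1 natrM.
rewrite cE // /a /wz_factor.
have -> : 64 ^+ n = 4 ^+ n * 16 ^+ n :> F by rewrite -exprMn -natrM.
have n4 : 4 ^+ n != 0 :> F by rewrite expf_neq0 // pnatr_eq0.
have n16 : 16 ^+ n != 0 :> F by rewrite expf_neq0 // pnatr_eq0.
move: (pochhammer h n) (4 ^+ n) (16 ^+ n) n`!%:R n4 n16 nf => P u v w u0 v0 w0.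
by field; rewrite u0 v0 w0.
Qed.

Lemma wz_sum0 n : (n <= N)%N ->
  wz_sum h c n 0 = (2 * n).+1`!%:R * \sum_(0 <= i < n.+1) a i.
Proof.
elim: n => [|n IHn] nN; first by rewrite big_nat1 -wz_summand0.
rewrite big_nat_recr // mulrDr -wz_summand0 // [LHS]/= IHn ?(ltnW nN) // !add0r.
have -> : (2 * n.+1 = (2 * n).+2)%N by lia.
congr (_ + _); rewrite (factS (2 * n).+2) (factS (2 * n).+1) !natrM.
by rewrite mulrAC -mulrA [RHS]mulrC; ring.
Qed.

End SumAtZero.

(** * Rationals with denominator prime to p *)

(* For prime p this is the localization Z_(p); asking for coprimality makes it
   a subring for every p. *)
Definition plocal (p : nat) := [pred x : rat | coprime p `|denq x|].

(** Any denominator prime to p will do, reduced or not; closure under the ring operations then only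
    takes products of denominators. *)
Lemma plocalP p (x : rat) :
  reflect (exists2 d : nat, d != 0%N /\ coprime p d & x * d%:R \is a Num.int)
          (x \in plocal p).
Proof.
apply: (iffP idP) => [px | [d [d0 pd] /intrP [a xa]]].
  exists `|denq x|%N; first by rewrite absz_eq0 denq_neq0.
  by rewrite natr_absz normr_denq -numqE intr_int.
have ddvd : (denq x %| d%:Z)%Z.
  have E : numq x * d%:Z = a * denq x.
    apply: (@intr_inj rat); rewrite !rmorphM /= numqE -xa.
    by rewrite mulrAC -pmulrn.
  have : (denq x %| numq x * d%:Z)%Z by rewrite E dvdz_mull.
  by rewrite Gauss_dvdzr // coprimezE coprime_sym; have := coprime_num_den x.
rewrite inE; apply: coprime_dvdr pd; exact: ddvd.
Qed.

Fact plocal_subring_closed p : subring_closed (plocal p).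
Proof.
split; first by rewrite inE coprimen1.
  move=> x y /plocalP [a [a0 pa] xa] /plocalP [b [b0 pb] yb].
  apply/plocalP; exists (a * b)%N.
  by rewrite muln_eq0 negb_or a0 coprimeMr pa.
  rewrite natrM (_ : _ * _ = x * a%:R * b%:R - y * b%:R * a%:R); last by ring.
  by rewrite rpredB // rpredM // rpred_nat.
move=> x y /plocalP [a [a0 pa] xa] /plocalP [b [b0 pb] yb].
apply/plocalP; exists (a * b)%N.
  by rewrite muln_eq0 negb_or a0 coprimeMr pa.
by rewrite natrM mulrACA rpredM.
Qed.

HB.instance Definition _ p :=
  GRing.isSubringClosed.Build rat (plocal p) (plocal_subring_closed p).

Record zloc (p : nat) := Zloc { zval : rat; _ : zval \in plocal p }.

HB.instance Definition _ p := [isSub for @zval p].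
HB.instance Definition _ p := [Choice of zloc p by <:].
HB.instance Definition _ p := [SubChoice_isSubComNzRing of zloc p by <:].

Lemma zloc_mulfI p (a x y : zloc p) : val a != 0 -> a * x = a * y -> x = y.
Proof.
move=> a0 /(congr1 val); rewrite !rmorphM /= => /(mulfI a0); exact: val_inj.
Qed.

Section Residue.
Variables (p : nat) (p_pr : prime p).

(* The proof of primality is an argument only so that the ring morphism
   structure, which depends on it, can be inferred. *)
Definition zred of prime p := fun x : zloc p => ratr (val x) : 'F_p.

Lemma Fp_nat_eq0 d : (d%:R == 0 :> 'F_p) = (p %| d)%N.
Proof. by rewrite (dvdn_pcharf (pchar_Fp p_pr)). Qed.

Lemma Fp_int_eq0 (a : int) : (a%:~R == 0 :> 'F_p) = (p %| `|a|)%N.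
Proof.
by case: (intP a) => [|n|n]; rewrite ?abszN ?rmorphN ?oppr_eq0 -?Fp_nat_eq0.
Qed.

Lemma denq_Fp (x : zloc p) : (denq (val x))%:~R != 0 :> 'F_p.
Proof. by rewrite Fp_int_eq0 -prime_coprime //; exact: (valP x). Qed.

(** The residue can be computed from an unreduced fraction, which is what sums and products of
    reduced fractions give. *)
Lemma zredE (x : zloc p) (a b : int) :
  b%:~R != 0 :> 'F_p -> val x * b%:~R = a%:~R -> zred p_pr x = a%:~R / b%:~R.
Proof.
move=> b0 xab; rewrite /zred /ratr; apply/eqP.
rewrite eqr_div ?denq_Fp // -!rmorphM /=; apply/eqP; congr _%:~R.
by apply: (@intr_inj rat); rewrite !rmorphM /= -xab numqE mulrAC.
Qed.

Fact zred_zmod_morphism : zmod_morphism (zred p_pr).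
Proof.
move=> x y; rewrite [X in _ = X - _]/zred [X in _ = _ - X]/zred /ratr.
rewrite (@zredE _ (numq (val x) * denq (val y) - numq (val y) * denq (val x))
           (denq (val x) * denq (val y))).
- by rewrite intrB !intrM -[in RHS]mulNr addf_div ?denq_Fp // mulNr.
- by rewrite rmorphM mulf_neq0 ?denq_Fp.
rewrite rmorphB intrB !intrM /= !numqE.
move: (zval x) (zval y) => r t; ring.
Qed.

Fact zred_monoid_morphism : monoid_morphism (zred p_pr).
Proof.
split; first by rewrite (@zredE _ 1 1) ?divr1 ?oner_eq0 // rmorph1 mulr1.
move=> x y; rewrite [X in _ = X * _]/zred [X in _ = _ * X]/zred /ratr.
rewrite (@zredE _ (numq (val x) * numq (val y)) (denq (val x) * denq (val y))).
- by rewrite !intrM mulf_div.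
- by rewrite rmorphM mulf_neq0 ?denq_Fp.
rewrite rmorphM !intrM /= !numqE.
move: (zval x) (zval y) => r t; ring.
Qed.

HB.instance Definition _ :=
  GRing.isZmodMorphism.Build (zloc p) 'F_p (zred p_pr) zred_zmod_morphism.
HB.instance Definition _ :=
  GRing.isMonoidMorphism.Build (zloc p) 'F_p (zred p_pr) zred_monoid_morphism.

Lemma zred_eq0 (x : zloc p) : zred p_pr x = 0 -> exists y, x = p%:R * y.
Proof.
move=> /eqP; rewrite mulf_eq0 invr_eq0 (negPf (denq_Fp x)) orbF Fp_int_eq0.
move=> /dvdnP [k nk].
have pR : p%:R != 0 :> rat by rewrite pnatr_eq0 -lt0n prime_gt0.
have xp : val x / p%:R \in plocal p.
  apply/plocalP; exists `|denq (val x)|%N.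
    by rewrite absz_eq0 denq_neq0; split => //; exact: (valP x).
  rewrite natr_absz normr_denq mulrAC -numqE [numq _]intEsign nk.
  rewrite rmorphM /= -pmulrn natrM mulrA mulfK //.
  by rewrite rpredM ?intr_int ?rpred_nat.
by exists (Zloc xp); apply: val_inj; rewrite rmorphM rmorph_nat /= mulrC divfK.
Qed.

Lemma zred_unit (x : zloc p) : zred p_pr x != 0 -> exists y, x * y = 1.
Proof.
rewrite mulf_eq0 invr_eq0 (negPf (denq_Fp x)) orbF Fp_int_eq0 => xn.
have x0 : val x != 0 by apply: contraNneq xn => ->; rewrite absz0 dvdn0.
have xV : (val x)^-1 \in plocal p.
  apply/plocalP; exists `|numq (val x)|%N.
    by rewrite absz_eq0 numq_eq0 x0 prime_coprime.
  rewrite natr_absz intr_norm numqE normrM normrEsign mulrA mulrCA mulVf //.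
  by rewrite mulr1 -intr_norm rpredM ?intr_int // rpredX ?rpredN.
by exists (Zloc xV); apply: val_inj; rewrite rmorphM rmorph1 /= mulfV.
Qed.

End Residue.

(** * Reduction modulo p *)

Section Periodic.
Variables (p : nat) (p_pr : prime p).
Implicit Types Y q : {poly 'F_p}.
Let P : {poly 'F_p} := 'X^p - 'X.

(** Frobenius gives (X + 1)^p = X^p + 1. *)
Lemma comp_artin_schreier : P \Po ('X + 1) = P.
Proof.
rewrite /P comp_polyB comp_polyX comp_Xn_poly.
have pP : p \in [pchar {poly 'F_p}] by rewrite pchar_poly pchar_Fp.
by rewrite exprDn_pchar ?pnatE // expr1n; ring.
Qed.

Lemma size_artin_schreier : size P = p.+1.
Proof.
by rewrite /P size_polyDl size_polyXn // size_polyN size_polyX ltnS prime_gt1.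
Qed.

(** A periodic Y takes the value Y(0) on all of F_p, so Y - Y(0) is divisible by the product of all
    X - a, which is X^p - X; the quotient inherits periodicity. *)
Lemma periodic_div Y : Y \Po ('X + 1) = Y ->
  exists q, [/\ q \Po ('X + 1) = q, Y = q * P + (Y.[0])%:P &
                (size q <= size Y - p)%N].
Proof.
move=> Yper; set Z := Y - (Y.[0])%:P.
have P0 : P != 0 by rewrite -size_poly_eq0 size_artin_schreier.
have Ynat k : Y.[k%:R] = Y.[0].
  elim: k => // k <-.
  by rewrite -{2}Yper horner_comp !hornerE natr1.
have PZ : P %| Z.
  have -> : P = \prod_(x : 'F_p) ('X - x%:P).
    by rewrite -finField_genPoly card_Fp.
  apply: uniq_roots_dvdp.
    apply/allP => x _; rewrite /root /Z hornerD hornerN hornerC.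
    by have := Ynat x; rewrite natr_Zp => ->; rewrite subrr.
  rewrite uniq_rootsE; apply: index_enum_uniq.
have ZE := divpK PZ.
exists (Z %/ P); split.
- apply: (mulIf P0); rewrite ZE -{2}comp_artin_schreier -comp_polyM ZE.
  by rewrite /Z comp_polyB Yper comp_polyC.
- by rewrite ZE /Z subrK.
rewrite size_divp // size_artin_schreier /=.
apply: leq_sub2r; rewrite /Z; case: (eqVneq Y 0) => [-> | Y0].
  by rewrite horner0 subr0.
apply: leq_trans (size_polyD _ _) _.
rewrite geq_max leqnn size_polyN (leq_trans (size_polyC_leq1 _)) //.
by rewrite size_poly_gt0.
Qed.

(** Two divisions write Y as (r P + b) P + a with r constant. Below degree p such a polynomial has
    terms in 1, X and X^2 only. *)
Lemma periodic_coef Y i : Y \Po ('X + 1) = Y -> (size Y <= (2 * p).+1)%N ->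
  (2 < i < p)%N -> Y`_i = 0.
Proof.
move=> Yper sY /andP [i2 ip].
have [q [qper YE sq]] := periodic_div Yper.
have [r [_ qE sr]] := periodic_div qper.
have p1 := prime_gt1 p_pr.
(* Below degree p, multiplication by X^p - X is a shift with a change of sign. *)
have low (s : {poly 'F_p}) a j : (0 < j < p)%N ->
    (s * P + a%:P)`_j = - s`_j.-1.
  case/andP=> j0 jp; rewrite coefD coefC gtn_eqF // addr0 mulrBr coefB.
  by rewrite coefMXn jp sub0r coefMX gtn_eqF.
rewrite YE low; last by rewrite ip (ltn_trans _ i2).
rewrite qE low; last by apply/andP; split; lia.
rewrite nth_default ?oppr0 //; apply: leq_trans sr _; rewrite leq_subLR.
apply: leq_trans sq _; rewrite leq_subLR; apply: leq_trans sY _; lia.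
Qed.

End Periodic.

Section ResidueField.
Variables (N p : nat).
Hypotheses (p_pr : prime p) (pE : p = (2 * N).+1) (p_ge5 : (4 < p)%N).
Local Notation K := {poly 'F_p}.

Lemma Fp_p0 : p%:R = 0 :> 'F_p.
Proof. by apply/eqP; rewrite Fp_nat_eq0. Qed.

Lemma Fp_2N1 : 1 + N%:R + N%:R = 0 :> 'F_p.
Proof.
have -> : 1 + N%:R + N%:R = (2 * N).+1%:R :> 'F_p by rewrite -natr1 natrM; ring.
by rewrite -pE Fp_p0.
Qed.

Variable h : 'F_p.
Hypothesis hN0 : h + N%:R = 0.

Lemma Fp_half : 1 + N%:R = h.
Proof. by apply: (addIr N%:R); rewrite hN0 Fp_2N1. Qed.

Lemma Fp_half_poly : 1 + N%:R = h%:P :> K.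
Proof. by rewrite -Fp_half polyCD polyC1 polyC_natr. Qed.

Lemma pochhammer_refl_Fp (a b : K) :
  a + b = 1 - N%:R -> pochhammer a N = (-1) ^+ N * pochhammer b N.
Proof. by move=> ab; rewrite pochhammer_refl -ab addrC addKr. Qed.

Lemma half_reflect : h%:P - 'X + (1 + 'X) = 1 - N%:R :> K.
Proof.
move/eqP: hN0; rewrite addr_eq0 => /eqP ->; rewrite polyCN polyC_natr.
ring.
Qed.

Lemma one_reflect : 1 - 'X + (h%:P + 'X) = 1 - N%:R :> K.
Proof. by rewrite -half_reflect; ring. Qed.

(** The shift trades the factor X for X + p, which is X again. *)
Lemma pochhammer_periodic : pochhammer 'X p \Po ('X + 1) = pochhammer 'X p :> K.
Proof.
have X0 : 'X != 0 :> K by rewrite polyX_eq0.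
apply: (mulfI X0).
rewrite -/(comp_poly ('X + 1) _) rmorph_pochhammer /= comp_polyX.
by rewrite -pochhammerSl pochhammerSr -polyC_natr Fp_p0 addr0 mulrC.
Qed.

(** Times X, this product is the periodic (X)_p, whose X^3 coefficient vanishes. *)
Lemma coef2_one_double : (pochhammer (1 + 'X : K) (2 * N))`_2 = 0.
Proof.
have -> : (pochhammer (1 + 'X : K) (2 * N))`_2 = (pochhammer ('X : K) p)`_3.
  have -> : pochhammer 'X p = 'X * pochhammer (1 + 'X) (2 * N) :> K.
    by rewrite addrC -pochhammerSl -pE.
  by rewrite coefXM.
apply: (periodic_coef p_pr pochhammer_periodic); last by rewrite (ltnW p_ge5).
apply: leq_trans (size_pochhammer _ _) _; rewrite ?size_polyX //.
by rewrite ltnS leq_pmull.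
Qed.

(** Since 1/2 = 1 + N modulo p, the two products join into (1 + X)_(2N). The two even products below
    reduce to this one by reflection, up to sign. *)
Lemma coef2_half_one :
  (pochhammer (h%:P + 'X : K) N * pochhammer (1 + 'X : K) N)`_2 = 0.
Proof.
have -> : pochhammer (h%:P + 'X : K) N * pochhammer (1 + 'X : K) N
    = pochhammer (1 + 'X) (2 * N).
  by rewrite mul2n -addnn pochhammerD addrAC Fp_half_poly; apply: mulrC.
exact: coef2_one_double.
Qed.

Lemma coef2_half_even :
  (pochhammer (h%:P + 'X : K) N * pochhammer (h%:P - 'X : K) N)`_2 = 0.
Proof.
rewrite (pochhammer_refl_Fp half_reflect).
have := coef2_half_one; move: (pochhammer _ N) (pochhammer _ N) => d g gd.
have -> : g * ((-1) ^+ N * d) = (-1) ^+ N * (g * d) by ring.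
by rewrite -signr_odd; case: odd; rewrite ?mulN1r ?mul1r ?coefN gd ?oppr0.
Qed.

Lemma coef2_one_even :
  (pochhammer (1 + 'X : K) N * pochhammer (1 - 'X : K) N)`_2 = 0.
Proof.
rewrite (pochhammer_refl_Fp one_reflect).
have := coef2_half_one; move: (pochhammer _ N) (pochhammer _ N) => d g gd.
have -> : d * ((-1) ^+ N * g) = (-1) ^+ N * (g * d) by ring.
by rewrite -signr_odd; case: odd; rewrite ?mulN1r ?mul1r ?coefN gd ?oppr0.
Qed.

(** The boundary term has the factor h + N = 0, leaving Q(X + 1)(X + h) = (X + 1) Q(X). The product
    d = (1 + X)_N obeys the opposite relation d(X + 1)(X + 1) = d(X)(X + h), so Q d is periodic. *)
Lemma coef4_wz (c : nat -> 'F_p) :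
    (forall n, (n < N)%N -> 16 * n.+1%:R ^+ 2 * c n.+1 = c n * (h + n%:R)) ->
  (wz_poly h c N * pochhammer (1 + 'X) N)`_4 = 0.
Proof.
move=> cS; have h2 : 2 * h = 1.
  by rewrite -[RHS]addr0 -Fp_2N1 -Fp_half; ring.
have := wz_poly_telescope h2 cS.
have -> : h%:P + N%:R = 0 :> K by rewrite -polyC_natr -polyCD hN0.
rewrite mulr0 !mul0r addr0 -pE.
have -> : ('X + p.+1%:R : K) = 'X + 1.
  by rewrite mulrSr -polyC_natr Fp_p0 add0r.
have := size_wz_poly h c N; move: (wz_poly h c N) => Q sQ QE.
set d := pochhammer _ N.
have dE : (d \Po ('X + 1)) * ('X + 1) = d * ('X + h%:P) :> K.
  rewrite -/(comp_poly ('X + 1) _) rmorph_pochhammer rmorphD rmorph1 /= comp_polyX.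
  rewrite -[RHS]/(pochhammer _ N * _) -Fp_half_poly.
  have -> : 'X + (1 + N%:R) = 1 + 'X + N%:R :> K by ring.
  by rewrite -pochhammerSr pochhammerSl mulrC addrC [1 + 'X + 1]addrC.
have X1 : 'X + 1 != 0 :> K by rewrite -size_poly_eq0 size_XaddC.
have Xh : 'X + h%:P != 0 :> K by rewrite -size_poly_eq0 size_XaddC.
apply: (periodic_coef p_pr); last by rewrite p_ge5.
  apply: (mulIf X1); apply: (mulIf Xh); rewrite comp_polyM.
  transitivity ((Q \Po ('X + 1)) * ('X + h%:P) * ((d \Po ('X + 1)) * ('X + 1))).
    by ring.
  by rewrite QE dE; ring.
have sd : (size d <= N.+1)%N.
  apply: size_pochhammer; apply: size_add_bound; last by rewrite size_polyX.
  by rewrite size_poly1.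
(* The bound is attained: (3N + 3) + (N + 1) - 1 = 2p + 1. *)
by apply: leq_trans (size_mul_bound sQ sd) _; rewrite pE; lia.
Qed.

End ResidueField.

(** * Congruences modulo powers of p *)

Section Congruence.
Variables (R : comNzRingType) (p : R).
Implicit Types (x y z : R) (f g : {poly R}) (m : nat).

Definition congp m x y := exists z, x = y + p ^+ m * z.

Lemma congp_refl m x : congp m x x.
Proof. by exists 0; rewrite mulr0 addr0. Qed.

Lemma congp_sym m x y : congp m x y -> congp m y x.
Proof. by case=> z ->; exists (- z); ring. Qed.

Lemma congp_trans m y x z : congp m x y -> congp m y z -> congp m x z.
Proof. by case=> a -> [b ->]; exists (a + b); ring. Qed.

Lemma congpD m x y x' y' :
  congp m x x' -> congp m y y' -> congp m (x + y) (x' + y').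
Proof. by case=> a -> [b ->]; exists (a + b); ring. Qed.

Lemma congpM m x y x' y' :
  congp m x x' -> congp m y y' -> congp m (x * y) (x' * y').
Proof.
case=> a -> [b ->]; exists (a * y' + x' * b + p ^+ m * a * b); ring.
Qed.

Lemma congpMp m x y : congp m x y -> congp m.+1 (p * x) (p * y).
Proof. by case=> a ->; exists a; rewrite exprS; ring. Qed.

Lemma congp_unit m u v x y :
  u * v = 1 -> congp m (u * x) (u * y) -> congp m x y.
Proof.
move=> uv [a E]; exists (v * a).
transitivity (v * (u * x)); first by rewrite mulrA [v * u]mulrC uv mul1r.
by rewrite E mulrDr mulrA [v * u]mulrC uv mul1r; ring.
Qed.

Lemma horner_taylor4 f x : exists z,
  f.[x] = f`_0 + f`_1 * x + f`_2 * x ^+ 2 + f`_3 * x ^+ 3 + z * x ^+ 4.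
Proof.
exists (drop_poly 4 f).[x]; rewrite -{1}(poly_take_drop 4 f).
rewrite hornerD hornerM hornerXn; congr (_ + _).
by rewrite horner_poly !big_ord_recr big_ord0 /=; ring.
Qed.

Lemma horner_deriv_taylor3 f x : exists z,
  f^`().[x] = f`_1 + 2 * f`_2 * x + 3 * f`_3 * x ^+ 2 + z * x ^+ 3.
Proof.
have [z ->] := horner_taylor4 f^`() x.
exists (f`_4 *+ 4 + z * x); rewrite !coef_deriv; ring.
Qed.

(* On the multiples of p a flat polynomial is constant modulo p^3 and its
   derivative vanishes modulo p^2. *)
Definition flat f := congp 2 f`_1 0 /\ congp 1 f`_2 0.

Lemma flatM f g : flat f -> flat g -> flat (f * g).
Proof.
case=> [[a fa] [b fb]] [[a' ga] [b' gb]]; split.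
  rewrite coefM !big_ord_recr big_ord0 /= fa ga.
  by exists (f`_0 * a' + a * g`_0); ring.
rewrite coefM !big_ord_recr big_ord0 /= fa ga fb gb.
by exists (f`_0 * b' + p ^+ 3 * a * a' + b * g`_0); ring.
Qed.

Lemma flatZ a f : flat f -> flat (a%:P * f).
Proof.
move=> [[b fb] [d fd]]; rewrite /flat !coefCM fb fd.
by split; [exists (a * b) | exists (a * d)]; ring.
Qed.

Lemma flat_horner f y : flat f -> congp 3 f.[p * y] f`_0.
Proof.
case=> [[a fa] [b fb]]; have [z ->] := horner_taylor4 f (p * y).
rewrite fa fb.
by exists (a * y + b * y ^+ 2 + f`_3 * y ^+ 3 + p * z * y ^+ 4); ring.
Qed.

Lemma flat_deriv f y : flat f -> congp 2 f^`().[p * y] 0.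
Proof.
case=> [[a fa] [b fb]]; have [z ->] := horner_deriv_taylor3 f (p * y).
rewrite fa fb.
by exists (a + 2 * b * y + 3 * f`_3 * y ^+ 2 + p * z * y ^+ 3); ring.
Qed.

(** In the Taylor expansion of f(py) = f(0) the linear term balances terms divisible by p^3;
    cancelling p and the unit y leaves p^2 dividing the linear coefficient. *)
Lemma flat_reflect f y v : (forall x z, p * x = p * z -> x = z) ->
  y * v = 1 -> f.[p * y] = f`_0 -> congp 1 f`_2 0 -> flat f.
Proof.
move=> pI yv E f2; split=> //; have [z Ez] := horner_taylor4 f (p * y).
have [b fb] := f2.
have : p * (y * f`_1) = p * (- p ^+ 2 * (b * y ^+ 2 + f`_3 * y ^+ 3
     + z * p * y ^+ 4)).
  apply: (addrI f`_0); rewrite -{2}E Ez fb; ring.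
move/pI => Ey; apply: (congp_unit yv).
by exists (- (b * y ^+ 2 + f`_3 * y ^+ 3 + z * p * y ^+ 4)); rewrite Ey; ring.
Qed.

Lemma flat_even f : congp 1 (f * (f \Po - 'X))`_2 0 -> flat (f * (f \Po - 'X)).
Proof.
move=> f2; split=> //.
have -> : (f * (f \Po - 'X))`_1 = 0; last exact: congp_refl.
set g := _ * _; have <- : g^`().[0] = g`_1.
  by rewrite horner_coef0 coef_deriv mulr1n.
rewrite derivM deriv_comp derivN derivX !(hornerE, horner_comp) oppr0 /=; ring.
Qed.

(* Hermite interpolation at the simple node py and the double node -py. *)
Lemma horner_hermite f y : congp 1 f`_3 0 ->
  congp 4 (4 * f`_0)
    (f.[p * y] + 3 * f.[- (p * y)] + 2 * (p * y) * f^`().[- (p * y)]).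
Proof.
move=> [d fd]; have [z1 ->] := horner_taylor4 f (p * y).
have [z2 ->] := horner_taylor4 f (- (p * y)).
have [z3 ->] := horner_deriv_taylor3 f (- (p * y)).
rewrite fd.
exists (- (4 * y ^+ 3 * d + z1 * y ^+ 4 + 3 * z2 * y ^+ 4 - 2 * z3 * y ^+ 4)).
ring.
Qed.

End Congruence.

(** * Interpolation modulo p^4 *)

Section Assembly.
(** In the application q = p, h = 1/2, H = p/2, s = (-1)^N, w = N!, t = 16^N, c = c_N, P = (1/2)_N
    and F = (2N)!. Further, Q is [wz_poly], D = (1 + X)_N, Phi and W are D times the quotient and
    the last term, J = (1 + X)_(2N), E = (1/2 + X)_N (1/2 - X)_N and E' = (1 + X)_N (1 - X)_N.
    Comparing a flat polynomial at H and at 0 yields relations modulo p^3 among these constants. *)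
Variables (R : comNzRingType) (q h H s w t c P F : R).
Variables (Q D Phi W J E E' : {poly R}).
Hypothesis HE : H = q * h.
Hypotheses (h2 : 2 * h = 1) (ss : s * s = 1).
Hypotheses (w_unit : exists v, w * v = 1) (t_unit : exists v, t * v = 1).
Hypothesis H_reg : forall x y, 3 * H * x = 3 * H * y -> x = y.
Hypotheses (cE : t * w ^+ 2 * c = P) (FE : F ^+ 2 = t * (P * w) ^+ 2).
Hypothesis QD : Q * D = ('X + q%:P) * Phi - 3 * 'X ^+ 2 * W.
Hypotheses (Q_H : w * Q.[H] = 48 * H ^+ 2 * P * J.[H])
  (Q_NH : Q.[- H] = 0) (dQ_NH : Q^`().[- H] = 16 * s * w * P * H).
Hypothesis D_NH : D.[- H] = s * P.
Hypotheses (flatJ : flat q J) (J_0 : J`_0 = F).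
Hypotheses (flatE : flat q E) (E_0 : E`_0 = P ^+ 2) (E_H : E.[H] = s * F).
Hypotheses (flatE' : flat q E') (E'_0 : E'`_0 = w ^+ 2)
  (E'_H : E'.[H] = s * P * D.[H]).
Hypotheses (flatW : flat q W) (W_0 : W`_0 = c * P ^+ 3 * w).
Hypothesis Phi_3 : congp q 1 Phi`_3 0.

Let J_H : congp q 3 J.[H] F.
Proof. by rewrite -J_0 HE; apply: flat_horner. Qed.

Let P2_F : congp q 3 (P ^+ 2) (s * F).
Proof. by apply: congp_sym; rewrite -E_H -E_0 HE; apply: flat_horner. Qed.

Let DP : congp q 3 (s * P * D.[H]) (w ^+ 2).
Proof. by rewrite -E'_H -E'_0 HE; apply: flat_horner. Qed.

Let W_H : congp q 3 W.[H] W`_0.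
Proof. by rewrite HE; apply: flat_horner. Qed.

Let W_NH : congp q 3 W.[- H] W`_0.
Proof. by rewrite HE -mulrN; apply: flat_horner. Qed.

Let dW_NH : congp q 2 W^`().[- H] 0.
Proof. by rewrite HE -mulrN; apply: flat_deriv. Qed.

(** After multiplication by the unit t w^2 the left side is P^4 w. Replacing P^2 by s F twice gives
    F^2 w, the exact value of F^2 brings back one P^2, and that is replaced once more. *)
Let W0_F : congp q 3 W`_0 (s * F * w).
Proof.
have [v wv] := w_unit; have [u tu] := t_unit.
have tw : t * w ^+ 2 * (u * v ^+ 2) = 1.
  by transitivity ((t * u) * (w * v) ^+ 2); [ring | rewrite tu wv; ring].
apply: (congp_unit tw); rewrite W_0.
have -> : t * w ^+ 2 * (c * P ^+ 3 * w) = P ^+ 2 * P ^+ 2 * w.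
  by rewrite -[in RHS]cE -{1}cE; ring.
have -> : t * w ^+ 2 * (s * F * w) = t * w ^+ 2 * w * (s * F) by ring.
apply: (@congp_trans _ _ _ (s * F * (s * F) * w)).
  by do !apply: congpM => //; apply: congp_refl.
have -> : s * F * (s * F) * w = t * w ^+ 2 * w * P ^+ 2.
  by transitivity ((s * s) * F ^+ 2 * w); [ring | rewrite ss FE; ring].
by apply: congpM; [apply: congp_refl | apply: P2_F].
Qed.

Let qH : q = 2 * H.
Proof. by rewrite HE mulrCA h2 mulr1. Qed.

Let H_mulI x y : H * x = H * y -> x = y.
Proof. by move=> E0; apply: H_reg; rewrite -!mulrA E0. Qed.

Let congpH m x y : congp q m x y -> congp q m.+1 (H * x) (H * y).
Proof.
move=> xy; rewrite HE [q * h]mulrC -!mulrA.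
by apply: congpM; [apply: congp_refl | apply: congpMp].
Qed.

(** At x = -H the factor x + q equals H, which can be cancelled. *)
Let Phi_NH : Phi.[- H] = 3 * H * W.[- H].
Proof.
apply: H_mulI; have := congr1 (fun f => f.[- H]) QD.
rewrite !(hornerM, hornerD, hornerN, hornerX, hornerC) Q_NH mul0r qH.
move=> /esym E0; apply/eqP; rewrite -subr_eq0 -E0; apply/eqP; ring.
Qed.

Let dPhi_NH : H * Phi^`().[- H] =
  16 * w * P ^+ 2 * H - 9 * H * W.[- H] + 3 * H ^+ 2 * W^`().[- H].
Proof.
have := congr1 (fun f => f^`().[- H]) QD.
rewrite -polyC_natr !(derivM, derivD, derivN, derivXn, derivX, derivC).
rewrite !(hornerM, hornerD, hornerN, hornerMn, hornerX, hornerC).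
rewrite Q_NH dQ_NH D_NH Phi_NH qH mul0r addr0.
have -> : 16 * s * w * P * H * (s * P) = 16 * w * P ^+ 2 * H * (s * s) by ring.
rewrite ss mulr1 => -> /=; ring.
Qed.

(** At x = H the factor x + q equals 3H. It cancels exactly and still leaves a factor H, which lifts
    congruences modulo p^3 to p^4. *)
Let Phi_H : congp q 4 Phi.[H] (H * W`_0 + 16 * H * (s * F * w)).
Proof.
have [v wv] := w_unit; apply: (congp_unit wv).
have E0 : w * Phi.[H] = w * (H * W.[H]) + 16 * (H * (s * J.[H] * (s * P * D.[H]))).
  have E1 := congr1 (fun f => f.[H]) QD.
  rewrite !(hornerM, hornerD, hornerN, hornerX, hornerC) qH in E1.
  apply: H_reg.
  transitivity (w * (Q.[H] * D.[H] + 3 * H ^+ 2 * W.[H])).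
    by rewrite E1; ring.
  transitivity (w * Q.[H] * D.[H] + 3 * H ^+ 2 * w * W.[H]); first by ring.
  rewrite Q_H.
  transitivity (48 * H ^+ 2 * P * J.[H] * D.[H] * (s * s) + 3 * H ^+ 2 * w * W.[H]).
    by rewrite ss mulr1.
  by ring.
rewrite E0 mulrDr.
have -> : w * (16 * H * (s * F * w)) = 16 * (H * (s * F * w ^+ 2)) by ring.
apply: congpD.
  by apply: congpM; [apply: congp_refl | apply: congpH].
apply: congpM; first exact: congp_refl.
apply: congpH; apply: congpM => //.
by apply: congpM => //; apply: congp_refl.
Qed.

Lemma congp_interpolation : congp q 4 Phi`_0 (5 * q * s * F * w).
Proof.
have four : 4 * h ^+ 2 = 1.
  by transitivity ((2 * h) ^+ 2); [ring | rewrite h2 expr1n].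
apply: (congp_unit four).
apply: (congp_trans (horner_hermite h Phi_3)); rewrite -HE.
rewrite -[2 * H * _]mulrA Phi_NH dPhi_NH.
set X := s * F * w.
have HW0 : congp q 4 (H * W`_0) (H * X) by apply: congpH; apply: W0_F.
have HW : congp q 4 (H * W.[- H]) (H * X).
  exact: congp_trans (congpH W_NH) HW0.
have HP : congp q 4 (H * (P ^+ 2 * w)) (H * X).
  by apply/congpH/congpM => //; apply: congp_refl.
have HdW : congp q 4 (H * (H * W^`().[- H])) 0.
  by rewrite -[0](mulr0 (H * H)) -mulrA; do 2!apply: congpH.
(* The weights add up to 17 + 9 + 32 - 18 = 40, and 40 H = 20 q. *)
have -> : 4 * (5 * q * s * F * w) = (H * X + 16 * (H * X)) + 9 * (H * X)
    + (32 * (H * X) - 18 * (H * X) + 6 * 0).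
  by rewrite qH /X; ring.
have -> : Phi.[H] + 3 * (3 * H * W.[- H]) + 2 * (16 * w * P ^+ 2 * H
    - 9 * H * W.[- H] + 3 * H ^+ 2 * W^`().[- H])
  = Phi.[H] + 9 * (H * W.[- H]) + (32 * (H * (P ^+ 2 * w))
    - 18 * (H * W.[- H]) + 6 * (H * (H * W^`().[- H]))) by ring.
have cst k x y : congp q 4 x y -> congp q 4 (k%:R * x) (k%:R * y).
  by apply: congpM; apply: congp_refl.
have cstN k x y : congp q 4 x y -> congp q 4 (- (k%:R * x)) (- (k%:R * y)).
  by rewrite -!mulNr; apply: congpM; apply: congp_refl.
do 2!apply: congpD; try exact: cst.
- apply: congp_trans Phi_H _; rewrite -/X -mulrA.
  by apply: congpD => //; apply: congp_refl.
- by apply: congpD; [apply: cst | apply: cstN].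
Qed.

End Assembly.

(** * The supercongruence *)

Section PochhammerPolynomials.
Variables (R : comNzRingType) (h H : R) (N : nat).
Hypotheses (h2 : 2 * h = 1) (hN : h + N%:R = H).
Local Notation K := {poly R}.

Lemma horner_add_pochhammer (a x : R) n :
  (pochhammer (a%:P + 'X : K) n).[x] = pochhammer (a + x) n.
Proof. by rewrite horner_pochhammer hornerD hornerC hornerX. Qed.

Lemma horner_sub_pochhammer (a x : R) n :
  (pochhammer (a%:P - 'X : K) n).[x] = pochhammer (a - x) n.
Proof. by rewrite horner_pochhammer hornerD hornerN hornerC hornerX. Qed.

(** Here h - H = -N; likewise h + H = N + 1 and 1 - 2H = -2N below, so these values are exact. *)
Lemma pochhammer_half_sub_half : pochhammer (h - H) N = (-1) ^+ N * N`!%:R.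
Proof.
rewrite [LHS]pochhammer_refl (_ : 1 - N%:R - (h - H) = 1) ?pochhammer1 //.
by rewrite -hN; ring.
Qed.

Lemma pochhammer_one_sub_half :
  pochhammer (1 - H) N = (-1) ^+ N * pochhammer h N.
Proof.
rewrite [LHS]pochhammer_refl (_ : 1 - N%:R - (1 - H) = h) //.
by rewrite -hN; ring.
Qed.

Lemma pochhammer_half_add_half : N`!%:R * pochhammer (h + H) N = (2 * N)`!%:R.
Proof.
rewrite -!pochhammer1 mul2n -addnn pochhammerD (_ : 1 + N%:R = h + H) //.
by rewrite -hN -h2; ring.
Qed.

Lemma pochhammer_one_sub_double : pochhammer (1 - 2 * H) (2 * N) = (2 * N)`!%:R.
Proof.
rewrite [LHS]pochhammer_refl (_ : 1 - (2 * N)%:R - (1 - 2 * H) = 1).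
  by rewrite pochhammer1 exprM sqrrN !expr1n mul1r.
by rewrite -hN mulrDr h2 natrM; ring.
Qed.

End PochhammerPolynomials.

Lemma unit_mulI (R : comNzRingType) (u v x y : R) :
  u * v = 1 -> u * x = u * y -> x = y.
Proof.
move=> uv E; rewrite -[x]mul1r -[y]mul1r -uv.
by rewrite [u * v]mulrC -!mulrA E.
Qed.

Section Localization.
Variables (N p : nat).
Hypothesis pE : p = (2 * N).+1.
Hypotheses (p_pr : prime p) (p_ge5 : (4 < p)%N).

Local Notation R := (zloc p).
Local Notation q := (p%:R : R).
Local Notation rho := (zred p_pr).

Lemma nat_unit n : (0 < n < p)%N -> exists v : R, n%:R * v = 1.
Proof.
move=> np; apply: (@zred_unit p p_pr); rewrite rmorph_nat Fp_nat_eq0 //.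
by rewrite gtnNdvd //; case/andP: np.
Qed.

Lemma mul_unit (x y : R) : (exists v, x * v = 1) -> (exists v, y * v = 1) ->
  exists v, x * y * v = 1.
Proof.
by move=> [a xa] [b yb]; exists (a * b); rewrite mulrACA xa yb mulr1.
Qed.

Lemma exp_unit (x : R) n : (exists v, x * v = 1) -> exists v, x ^+ n * v = 1.
Proof.
move=> xu; elim: n => [|n IHn]; first by exists 1; rewrite mulr1.
by rewrite exprS; apply: mul_unit.
Qed.

Lemma fact_unit n : (n < p)%N -> exists v : R, n`!%:R * v = 1.
Proof.
elim: n => [|n IHn] np; first by exists 1; rewrite mulr1.
by rewrite factS natrM; apply: mul_unit; [apply: nat_unit | apply/IHn/ltnW].
Qed.

Lemma exp2_unit n k : n = (2 ^ k)%N -> exists v : R, n%:R * v = 1.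
Proof.
move=> ->; rewrite natrX; apply/exp_unit/nat_unit.
by rewrite (leq_trans _ p_ge5).
Qed.

Lemma congp_coef (f : {poly R}) i :
  (map_poly rho f)`_i = 0 -> congp q 1 f`_i 0.
Proof.
by rewrite coef_map => /zred_eq0 [y ->]; exists y; rewrite add0r expr1.
Qed.

Lemma val_p_neq0 : val q != 0 :> rat.
Proof. by rewrite rmorph_nat pnatr_eq0 -lt0n prime_gt0. Qed.

Variables (h : R) (c : nat -> R).
Hypothesis h2 : 2 * h = 1.
Hypothesis cE : forall n, (n <= N)%N ->
  n`!%:R ^+ 2 * 16 ^+ n * c n = pochhammer h n.

Lemma val_h2 : 2 * val h = 1.
Proof. by have := congr1 val h2; rewrite rmorphM rmorph_nat rmorph1. Qed.

Lemma val_h_neq0 : val h != 0.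
Proof. by have := val_h2; case: eqVneq => // ->; lra. Qed.

Lemma wz_coef_rec n : (n < N)%N ->
  16 * n.+1%:R ^+ 2 * c n.+1 = c n * (h + n%:R).
Proof.
move=> nN; have np : (n < p)%N by rewrite pE; lia.
have [v uv] : exists v, n`!%:R ^+ 2 * 16 ^+ n * v = 1 :> R.
  apply: mul_unit; first by apply/exp_unit/fact_unit.
  by apply/exp_unit/(exp2_unit (k := 4)).
have E : n`!%:R ^+ 2 * 16 ^+ n * (16 * n.+1%:R ^+ 2 * c n.+1)
       = n`!%:R ^+ 2 * 16 ^+ n * (c n * (h + n%:R)).
  rewrite [RHS]mulrA cE 1?ltnW // -pochhammerSr -cE // factS natrM.
  by rewrite [16 ^+ n.+1]exprS; ring.
exact: unit_mulI uv E.
Qed.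

Lemma wz_coef0 : c 0%N = 1.
Proof. by have := @cE 0 isT; rewrite pochhammer0 expr0 mulr1 expr1n mul1r. Qed.

Lemma half_primeE : h + N%:R = q * h.
Proof.
have -> : q = 2 * N%:R + 1 by rewrite -natrM natr1 -pE.
by rewrite mulrDl mulrAC h2 !mul1r addrC.
Qed.

Lemma rho_half : rho h + N%:R = 0.
Proof.
by rewrite -(rmorph_nat rho) -rmorphD half_primeE rmorphM rmorph_nat
     Fp_p0 ?mul0r.
Qed.

Local Notation H := (q * h).
Local Notation K := {poly R}.
Local Notation s := ((-1) ^+ N : R).
Local Notation P := (pochhammer h N).

Lemma red_pochhammer_add (a : R) n :
  map_poly rho (pochhammer (a%:P + 'X : K) n)
  = pochhammer ((rho a)%:P + 'X) n.
Proof. by rewrite rmorph_pochhammer rmorphD /= map_polyX map_polyC. Qed.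

Lemma red_pochhammer_sub (a : R) n :
  map_poly rho (pochhammer (a%:P - 'X : K) n)
  = pochhammer ((rho a)%:P - 'X) n.
Proof. by rewrite rmorph_pochhammer rmorphB /= map_polyX map_polyC. Qed.

Lemma flat_half_even :
  flat q (pochhammer (h%:P + 'X : K) N * pochhammer (h%:P - 'X) N).
Proof.
have subE : pochhammer (h%:P - 'X : K) N = pochhammer (h%:P + 'X : K) N \Po - 'X.
  rewrite -[RHS]/(comp_poly (- 'X) _) rmorph_pochhammer rmorphD /=.
  by rewrite comp_polyC comp_polyX.
have := coef2_half_even p_pr pE p_ge5 rho_half.
rewrite -red_pochhammer_add -red_pochhammer_sub -rmorphM => /congp_coef.
by rewrite subE => /flat_even.
Qed.

Lemma flat_one_even :
  flat q (pochhammer (1%:P + 'X : K) N * pochhammer (1%:P - 'X) N).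
Proof.
have subE : pochhammer (1%:P - 'X : K) N = pochhammer (1%:P + 'X : K) N \Po - 'X.
  rewrite -[RHS]/(comp_poly (- 'X) _) rmorph_pochhammer rmorphD /=.
  by rewrite comp_polyC comp_polyX.
have := coef2_one_even p_pr pE p_ge5 rho_half.
rewrite -polyC1 -(rmorph1 rho).
rewrite -red_pochhammer_add -red_pochhammer_sub -rmorphM => /congp_coef.
by rewrite subE => /flat_even.
Qed.

Lemma p_mulI (x y : R) : q * x = q * y -> x = y.
Proof. exact/zloc_mulfI/val_p_neq0. Qed.

(** The reflection x -> -p - x preserves the product, so -p and 0 give the same value. *)
Lemma flat_one_double : flat q (pochhammer (1%:P + 'X : K) (2 * N)).
Proof.
apply: (flat_reflect (y := -1) (v := -1) p_mulI); first by rewrite mulrNN mulr1.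
  rewrite -horner_coef0 !horner_add_pochhammer addr0 mulrN1 pochhammer1.
  by rewrite -(pochhammer_one_sub_double h2 half_primeE) mulrCA h2 mulr1.
apply: congp_coef; rewrite red_pochhammer_add rmorph1 polyC1.
exact: coef2_one_double p_pr pE p_ge5.
Qed.

(** The reflection x -> -p/2 - x exchanges the two products up to a common sign, so -p/2 and 0 give
    the same value. *)
Lemma flat_half_one :
  flat q (pochhammer (h%:P + 'X : K) N * pochhammer (1%:P + 'X) N).
Proof.
apply: (flat_reflect (y := - h) (v := -2) p_mulI); first by rewrite mulrNN mulrC.
  rewrite -horner_coef0 !hornerM !horner_add_pochhammer !addr0 mulrN.
  rewrite (pochhammer_half_sub_half half_primeE).
  rewrite (pochhammer_one_sub_half half_primeE) pochhammer1.
  rewrite mulrACA -expr2 sqrr_sign mul1r; exact: mulrC.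
apply: congp_coef; rewrite rmorphM /= !red_pochhammer_add rmorph1 polyC1.
exact: (coef2_half_one p_pr pE p_ge5 rho_half).
Qed.

Lemma pochhammer_half_shift : pochhammer (h + 1) N = 2 * (P * H).
Proof.
apply: (unit_mulI (u := h) (v := 2)); first by rewrite mulrC.
rewrite -pochhammerSl pochhammerSr half_primeE.
by rewrite [RHS]mulrA [h * 2]mulrC h2 mul1r.
Qed.

Lemma wz_poly_half_prime :
  N`!%:R * (wz_poly h c N).[H]
  = 48 * H ^+ 2 * P * (pochhammer (1%:P + 'X) (2 * N)).[H].
Proof.
rewrite horner_wz_poly -{1}half_primeE wz_sum_half_nat ?wz_coef0 //; last first.
  exact: wz_coef_rec.
rewrite horner_add_pochhammer.
(* (3/2)_(3N+1) is cut after N factors. The first block contributes 2PH and the last factor of the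
   second is p + H = 3H, whence 48 = 8 * 2 * 3. *)
have -> : ((2 * N).+1 + N = N + (2 * N).+1)%N by rewrite addnC.
rewrite pochhammerD pochhammer_half_shift.
have -> : h + 1 + N%:R = 1 + H by rewrite -half_primeE; ring.
rewrite pochhammerSr.
have -> : 1 + H + (2 * N)%:R = 3 * H.
  by rewrite natrM -half_primeE -[X in X + _ + _]h2; ring.
ring.
Qed.

Lemma val_wz_poly :
  map_poly val (wz_poly h c N) = wz_poly (val h) (val \o c) N.
Proof.
rewrite (rmorph_wz_sum _ _ _ (d := polyC \o (val \o c))).
  by congr wz_sum; [apply: map_polyC | apply: map_polyX].
by move=> i; apply: map_polyC.
Qed.

Lemma val_pochhammer a n : val (pochhammer a n : R) = pochhammer (val a) n.
Proof. exact: rmorph_pochhammer. Qed.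

Lemma val_wz_coef_rec n : (n < N)%N ->
  16 * n.+1%:R ^+ 2 * (val \o c) n.+1 = (val \o c) n * (val h + n%:R).
Proof.
move=> /wz_coef_rec /(congr1 val).
by rewrite !rmorphM !rmorph_nat (rmorphD _ h) rmorph_nat.
Qed.

Lemma wz_poly_double_zero :
  (wz_poly h c N).[- H] = 0 /\
  (wz_poly h c N)^`().[- H] = 16 * s * N`!%:R * P * H.
Proof.
have val_wz_coef0 : (val \o c) 0%N = 1 by rewrite [LHS]/= wz_coef0.
have [] := wz_double_zero val_h2 val_wz_coef0 val_wz_coef_rec (leqnn N).
have -> : - val h - N%:R = val (- H).
  by rewrite -half_primeE rmorphN rmorphD rmorph_nat opprD.
rewrite -val_wz_poly deriv_map !horner_map => Q0 Q1; split.
  by apply: val_inj; rewrite Q0 rmorph0.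
apply: val_inj; move: Q1.
have -> : ((2 * N).+1 - N = N.+1)%N by lia.
(* The second half of (h + 1)_(2N) cancels against the product on the left, and the first half is
   2PH. *)
rewrite mul2n -addnn pochhammerD mulrSr addrA [_ + _ + 1]addrAC.
have n0 : pochhammer (val h + 1 + N%:R) N != 0.
  apply/prodf_neq0 => i _; rewrite gt_eqF // -!addrA addr_gt0 //.
    by have := val_h2; lra.
  by rewrite ltr_wpDr ?ltr01 // addr_ge0 ?ler0n.
rewrite [X in _ = X -> _]mulrA => /(mulIf n0) ->.
have := congr1 val pochhammer_half_shift.
rewrite val_pochhammer rmorphD rmorph1 => ->.
by rewrite !rmorphM !rmorphXn rmorphN rmorph1 !rmorph_nat; ring.
Qed.

(** The index is [N.-1] because [wz_quot] counts from p = 2N + 3. *)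
Local Notation quot := (wz_quot h%:P (polyC \o c) N.-1 ('X : K)).
Local Notation term := (wz_term h%:P (polyC \o c) N ('X : K)).
Local Notation D := (pochhammer (1%:P + 'X : K) N).

Lemma wz_poly_quot :
  wz_poly h c N = ('X + q%:P) * quot - 3 * 'X ^+ 2 * term.
Proof.
have N0 : (0 < N)%N by move: p_ge5; rewrite pE; case: N.
have -> : q%:P = (2 * N).+1%:R :> K by rewrite polyC_natr -pE.
rewrite /wz_poly; move: (N.-1) (prednK N0) => m <-.
by rewrite wz_quotE mulnS.
Qed.

Lemma wz_term_split : term * D =
  (c N)%:P * ((pochhammer (h%:P + 'X : K) N * pochhammer (h%:P - 'X) N)
              * (pochhammer (h%:P + 'X : K) N * D)).
Proof.
rewrite /wz_term /=.
move: (pochhammer _ N) (pochhammer _ N) (pochhammer _ N) => x y z; ring.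
Qed.

Lemma flat_term : flat q (term * D).
Proof.
rewrite wz_term_split; apply/flatZ/flatM; first exact: flat_half_even.
exact: flat_half_one.
Qed.

Lemma red_wz_poly :
  map_poly rho (wz_poly h c N) = wz_poly (rho h) (rho \o c) N.
Proof.
rewrite (rmorph_wz_sum _ _ _ (d := polyC \o (rho \o c))).
  by congr wz_sum; [apply: map_polyC | apply: map_polyX].
by move=> i; apply: map_polyC.
Qed.

(** In (X + q) Phi - 3 X^2 W the coefficient of X^4 is that of X^3 in Phi, up to a multiple of p and
    to the X^2 coefficient of the flat W. *)
Lemma congp_quot3 : congp q 1 (quot * D)`_3 0.
Proof.
have QD4 : congp q 1 (wz_poly h c N * D)`_4 0.
  apply: congp_coef.
  rewrite rmorphM /= red_wz_poly red_pochhammer_add rmorph1 polyC1.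
  apply: (coef4_wz p_pr pE p_ge5 rho_half) => n nN /=.
  have := congr1 rho (wz_coef_rec nN).
  by rewrite !rmorphM !rmorph_nat (rmorphD _ h) rmorph_nat.
have [_ [b W2]] := flat_term; case: QD4 => [a].
have -> : wz_poly h c N * D = ('X * (quot * D)) + q%:P * (quot * D)
    - 3%:P * ((term * D) * 'X^2).
  by rewrite wz_poly_quot polyC_natr; ring.
rewrite coefB coefD coefXM !coefCM coefMXn /= W2 => E.
exists (a - (quot * D)`_4 + 3 * b); move: E.
move: ((quot * D)`_3) ((quot * D)`_4) => x y E.
transitivity (x + q * y - 3 * (0 + q ^+ 1 * b) - q * y + 3 * (q * b)).
  by ring.
by rewrite E; ring.
Qed.

Lemma congp_quot0 : congp q 4 quot.[0] (5 * q * s * (2 * N)`!%:R).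
Proof.
have [v wv] : exists v : R, N`!%:R * v = 1.
  by apply: fact_unit => //; rewrite pE; lia.
apply: (congp_unit wv).
have -> : N`!%:R * quot.[0] = (quot * D)`_0.
  rewrite -horner_coef0 hornerM horner_add_pochhammer addr0 pochhammer1.
  exact: mulrC.
have -> : N`!%:R * (5 * q * s * (2 * N)`!%:R)
    = 5 * q * s * (2 * N)`!%:R * N`!%:R.
  exact: mulrC.
have [Q0 dQ0] := wz_poly_double_zero.
apply: (@congp_interpolation _ q h H s N`!%:R (16 ^+ N) (c N) P (2 * N)`!%:R
  (wz_poly h c N) D (quot * D) (term * D) (pochhammer (1%:P + 'X : K) (2 * N))
  (pochhammer (h%:P + 'X : K) N * pochhammer (h%:P - 'X) N)
  (D * pochhammer (1%:P - 'X) N)) => //.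
- by rewrite -expr2 sqrr_sign.
- by exists v.
- by apply/exp_unit/(exp2_unit (k := 4)).
- move=> x y; apply: zloc_mulfI; rewrite !rmorphM rmorph_nat !mulf_neq0 //.
    exact: val_p_neq0.
  exact: val_h_neq0.
- by rewrite [_ * N`!%:R ^+ 2]mulrC cE.
- rewrite (fact_double _ h2) (_ : 16 ^+ N = 4 ^+ N * 4 ^+ N); first by ring.
  by rewrite -exprMn -natrM.
- by rewrite wz_poly_quot; ring.
- exact: wz_poly_half_prime.
- by rewrite horner_add_pochhammer (pochhammer_one_sub_half half_primeE).
- exact: flat_one_double.
- by rewrite -horner_coef0 horner_add_pochhammer addr0 pochhammer1.
- exact: flat_half_even.
- rewrite -horner_coef0 hornerM horner_add_pochhammer horner_sub_pochhammer.
  by rewrite addr0 subr0 expr2.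
- rewrite hornerM horner_add_pochhammer horner_sub_pochhammer.
  rewrite (pochhammer_half_sub_half half_primeE).
  rewrite -(pochhammer_half_add_half h2 half_primeE).
  by move: (pochhammer _ N) => x; ring.
- exact: flat_one_even.
- rewrite -horner_coef0 hornerM horner_add_pochhammer horner_sub_pochhammer.
  by rewrite addr0 subr0 pochhammer1 expr2.
- rewrite hornerM horner_sub_pochhammer (pochhammer_one_sub_half half_primeE).
  exact: mulrC.
- exact: flat_term.
- rewrite wz_term_split coefCM -horner_coef0 !hornerM !horner_add_pochhammer.
  rewrite horner_sub_pochhammer !addr0 subr0 pochhammer1.
  by move: P N`!%:R => x y; ring.
- exact: congp_quot3.
Qed.

End Localization.

(** The value is 0 when x is not a unit of Z_(p). *)
Definition zinv p (x : zloc p) : zloc p := insubd 0 (val x)^-1.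

Lemma mul_zinv p (x : zloc p) : (exists v, x * v = 1) -> x * zinv x = 1.
Proof.
case=> v xv; rewrite /zinv; suff -> : (val x)^-1 = val v by rewrite valKd.
have E : val x * val v = 1 by rewrite -rmorphM xv rmorph1.
have x0 : val x != 0.
  by apply: contra_eq_neq E => ->; rewrite mul0r eq_sym oner_eq0.
by apply: (mulfI x0); rewrite E mulfV.
Qed.

Lemma eqmod_powP p m (x y : rat) (z : zloc p) : prime p ->
  x = y + p%:R ^+ m * val z -> eqmod_pow p m x y.
Proof.
move=> p_pr ->; rewrite /eqmod_pow addrAC subrr add0r mulrC mulKf; last first.
  by rewrite expf_neq0 // pnatr_eq0 -lt0n prime_gt0.
by rewrite /dvdz /= -prime_coprime //; apply: (valP z).
Qed.

Lemma sum_supercongruence N p : p = (2 * N).+1 -> prime p -> (4 < p)%N ->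
  eqmod_pow p 4
    (\sum_(0 <= n < N.+1)
       pochhammer (1 / 2 : rat) n ^+ 3 / n`!%:R ^+ 3
         * (42 * n%:R + 5) * (1 / 64 ^+ n))
    (5 * p%:R * (-1) ^+ N).
Proof.
move=> pE p_pr p_ge5.
have u2 : exists v : zloc p, 2 * v = 1.
  exact: (exp2_unit p_pr p_ge5 (k := 1)).
pose h : zloc p := zinv 2; have h2 : 2 * h = 1 := mul_zinv u2.
pose d n : zloc p := n`!%:R ^+ 2 * 16 ^+ n.
pose c n : zloc p := zinv (d n) * pochhammer h n.
have d_unit n : (n <= N)%N -> exists v : zloc p, d n * v = 1.
  move=> nN; apply: mul_unit; apply: exp_unit.
    by apply: fact_unit => //; rewrite pE; lia.
  exact: (exp2_unit p_pr p_ge5 (k := 4)).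
have cE n : (n <= N)%N -> d n * c n = pochhammer h n.
  by move=> nN; rewrite mulrA mul_zinv ?mul1r //; apply: d_unit.
have half : val h = 1 / 2.
  by have := val_h2 h2; lra.
set S := \sum_(0 <= n < N.+1) _.
pose A0 := (wz_quot h%:P (polyC \o c) N.-1 'X).[0].
have A0E : val A0 = (2 * N)`!%:R * S.
  have p0 : p%:R != 0 :> rat by rewrite pnatr_eq0 -lt0n prime_gt0.
  (* At x = 0 the polynomial is both p times the quotient and (2N + 1)! S, where (2N + 1)! = p
     (2N)!. *)
  apply: (mulfI p0).
  transitivity (val ((wz_poly h c N).[0])).
    rewrite (wz_poly_quot pE p_ge5 h c) hornerD hornerM hornerD hornerX hornerC.
    rewrite add0r hornerN !hornerM hornerX mulr0 mulr0 mul0r subr0.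
    by rewrite rmorphM rmorph_nat.
  rewrite horner_wz_poly (@rmorph_wz_sum _ _ _ _ _ (val \o c)) // rmorph0.
  rewrite (wz_sum0 (N := N) (val_h2 h2)) //.
    by rewrite factS natrM mulrA -pE /S half.
  move=> n nN; have := congr1 val (cE n nN).
  rewrite !rmorphM !rmorphXn !rmorph_nat [val (pochhammer _ _)]rmorph_pochhammer.
  have dn0 : n`!%:R ^+ 2 * 16 ^+ n != 0 :> rat.
    by rewrite mulf_neq0 // expf_neq0 // pnatr_eq0 -lt0n fact_gt0.
  by move=> <-; rewrite [RHS]mulrC mulKf.
have [z Ez] := congp_quot0 pE p_pr p_ge5 h2 cE.
have [v Fv] : exists v : zloc p, (2 * N)`!%:R * v = 1.
  by apply: fact_unit => //; rewrite pE.
apply: (@eqmod_powP _ _ _ _ (v * z)) => //.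
have F0 : (2 * N)`!%:R != 0 :> rat by rewrite pnatr_eq0 -lt0n fact_gt0.
apply: (mulfI F0); rewrite -A0E.
have Fv' : (2 * N)`!%:R * val v = 1.
  by have := congr1 val Fv; rewrite rmorphM rmorph_nat rmorph1.
have -> : val A0 = 5 * p%:R * (-1) ^+ N * (2 * N)`!%:R + p%:R ^+ 4 * val z.
  by rewrite [A0]Ez rmorphD !rmorphM rmorph_sign !rmorph_nat.
have -> : val (v * z) = val v * val z by rewrite rmorphM.
rewrite mulrDr [X in _ = _ + X]mulrCA [X in _ = _ + _ * X]mulrA Fv' mul1r.
by congr (_ + _); apply: mulrC.
Qed.

Theorem theorem1p1 (p : nat) (p_prime : prime p) (p_odd : odd p) :
  eqmod_pow p 4
    (\sum_(0 <= n < ((p - 1) %/ 2).+1)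
       pochhammer (1 / 2 : rat) n ^+ 3 / n`!%:R ^+ 3
         * (42 * n%:R + 5) * (1 / 64 ^+ n))
    (5 * p%:R * (-1) ^+ ((p - 1) %/ 2)).
Proof.
have pE : p = (2 * ((p - 1) %/ 2)).+1.
  have := prime_gt0 p_prime; have := divn_eq p 2; rewrite modn2 p_odd; lia.
have [p5|p4] := ltnP 4 p; first exact: sum_supercongruence.
(* The coefficient argument requires p > 4, so p = 3 is computed: 5 + 47/512 + 15 = 81 * 127/512. *)
have -> : p = 3%N.
  by move: p4 p_odd (prime_gt1 p_prime); case: p {p_prime pE} => [|[|[|[|[|]]]]].
rewrite big_nat_recr // big_nat1 /pochhammer big_ord0 big_ord1.
by vm_compute.
Qed.
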